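(* Let $\{(x^k,y^k)\}$ be generated by the pdNCG method (described in the context), where the parameter $\eta$ of the CG termination criterion $\|H(x^k,y^k)d^k+\nabla f(x^k)\|\le \eta\|\nabla f(x^k)\|$ is a constant with $0\le\eta<1$. Let $x^*$ be the minimizer of $f(x)=\tau\psi_\mu(x)+\varphi(x)$. Then the dual variables satisfy $y^k\to D(x^* )x^*$. Consequently, the primal-dual iterates $(x^k,y^k)$ of pdNCG converge to the solution $(x,y)$ of the system $$\tau y+\nabla\varphi(x)=0,\qquad D(x)^{-1}y-x=0,\qquad \|y\|_\infty\le1 .$$
   Context: Problem. Let $\tau>0$, $\mu>0$, and let $\varphi:\mathbb{R}^m\to\mathbb{R}$ be twice differentiable with $\lambda_m I\preceq\nabla^2\varphi(x)\preceq\lambda_1 I$ for all $x$, where $0<\lambda_m\le\lambda_1$, and $\|\nabla^2\varphi(y)-\nabla^2\varphi(x)\|\le L_\varphi\|y-x\|$ for all $x,y$, where $L_\varphi\ge0$. Here $\|\cdot\|$ is the Euclidean norm for vectors and the spectral norm for matrices. Let $\psi_\mu(x)=\sum_{i=1}^m\big((\mu^2+x_i^2)^{1/2}-\mu\big)$ and $f(x)=\tau\psi_\mu(x)+\varphi(x)$. Notation. $D=D(x)$ is the diagonal matrix with $[D]_{ii}=(\mu^2+x_i^2)^{-1/2}$. For $x,y\in\mathbb{R}^m$, $H(x,y)=\tau D(I-D\,\mathrm{diag}(x)\mathrm{diag}(y))+\nabla^2\varphi(x)$, where $D=D(x)$. At iterate $(x^k,y^k)$ the local norm is $\|v\|_{x^k}=\sqrt{v^\intercal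 H(x^k,y^k)v}$. Algorithm pdNCG. Constants: $0<c_2<1/2$, $0<c_3<1$. Start from $x^0\in\mathbb{R}^m$ and $y^0\in\mathbb{R}^m$ with $\|y^0\|_\infty\le1$. For $k=0,1,2,\dots$: (i) Compute $d^k$ by applying the conjugate gradients (CG) method, in exact arithmetic and started from the zero vector, to $H(x^k,y^k)d=-\nabla f(x^k)$, stopping when the CG iterate $d$ satisfies $\|H(x^k,y^k)d+\nabla f(x^k)\|\le\eta\|\nabla f(x^k)\|$. (ii) With $D=D(x^k)$, set $\Delta y^k=D(I-D\,\mathrm{diag}(x^k)\mathrm{diag}(y^k))d^k-(y^k-Dx^k)$. (iii) Set $\tilde y^{k+1}=y^k+\Delta y^k$ and let $y^{k+1}$ be the orthogonal projection of $\tilde y^{k+1}$ onto $\{y:\|y\|_\infty\le1\}$. (iv) Find the least integer $j\ge0$ with $f(x^k+c_3^jd^k)\le f(x^k)-c_2c_3^j\|d^k\|_{x^k}^2$ and set $\alpha=c_3^j$. (v) Set $x^{k+1}=x^k+\alpha d^k$. The sequences are regarded as infinite (no stopping test). *)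

(* Defs.v *)
From HB Require Import structures.
From mathcomp Require Import all_boot all_order all_algebra.
From mathcomp Require Import all_classical all_reals all_analysis.

Set Implicit Arguments.
Unset Strict Implicit.
Unset Printing Implicit Defensive.

Import Order.TTheory GRing.Theory Num.Theory.
Import numFieldNormedType.Exports.

Local Open Scope classical_set_scope.
Local Open Scope ring_scope.

(* The points of R^m are column vectors. On them the library norm `|v| is the
   l-infinity norm (the maximum of the absolute values of the entries), so the
   Euclidean norm needs a definition of its own. *)

Definition dotp (R : realType) (m : nat) (u v : 'cV[R]_m) : R :=
  \sum_(i < m) u i 0 * v i 0.

Definition norm2 (R : realType) (m : nat) (v : 'cV[R]_m) : R :=
  Num.sqrt (dotp v v).

Definition spectral_norm (R : realType) (m : nat) (A : 'M[R]_m) : R :=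
  sup [set norm2 (A *m v) | v in [set v : 'cV[R]_m | norm2 v <= 1]].

Definition psdmx (R : realType) (m : nat) (A : 'M[R]_m) : Prop :=
  A^T = A /\ forall v : 'cV[R]_m, 0 <= dotp v (A *m v).

Definition loewner_le (R : realType) (m : nat) (A B : 'M[R]_m) : Prop :=
  psdmx (B - A).

Definition gradient (R : realType) (m : nat) (g : 'cV[R]_m -> R)
    (x : 'cV[R]_m) : 'cV[R]_m :=
  \col_(i < m) 'D_(delta_mx i 0 : 'cV[R]_m) g x.

Definition hessian (R : realType) (m : nat) (g : 'cV[R]_m -> R)
    (x : 'cV[R]_m) : 'M[R]_m :=
  \matrix_(i < m, j < m)
    'D_(delta_mx i 0 : 'cV[R]_m) (fun z => gradient g z j 0) x.

(* Differentiability is in the Frechet sense, here and for the gradient. *)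
Definition twice_differentiable (R : realType) (m : nat)
    (g : 'cV[R]_m -> R) : Prop :=
  (forall x, differentiable g x) /\ (forall x, differentiable (gradient g) x).

Definition psi (R : realType) (m : nat) (mu : R) (x : 'cV[R]_m) : R :=
  \sum_(i < m) (Num.sqrt (mu ^+ 2 + x i 0 ^+ 2) - mu).

Definition objective (R : realType) (m : nat) (tau mu : R)
    (phi : 'cV[R]_m -> R) (x : 'cV[R]_m) : R :=
  tau * psi mu x + phi x.

Definition Dmx (R : realType) (m : nat) (mu : R) (x : 'cV[R]_m) : 'M[R]_m :=
  diag_mx (\row_(i < m) (Num.sqrt (mu ^+ 2 + x i 0 ^+ 2))^-1).

Definition diagc (R : realType) (m : nat) (x : 'cV[R]_m) : 'M[R]_m :=
  diag_mx x^T.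

Definition Hmx (R : realType) (m : nat) (tau mu : R) (phi : 'cV[R]_m -> R)
    (x y : 'cV[R]_m) : 'M[R]_m :=
  tau *: (Dmx mu x *m (1%:M - Dmx mu x *m diagc x *m diagc y))
  + hessian phi x.

Definition local_norm (R : realType) (m : nat) (tau mu : R)
    (phi : 'cV[R]_m -> R) (x y v : 'cV[R]_m) : R :=
  Num.sqrt (dotp v (Hmx tau mu phi x y *m v)).

(* The state of the Hestenes-Stiefel recurrence for A d = b is the triple
   (iterate d, residual r = b - A d, search direction p). For positive definite
   A a denominator vanishes only when r = 0, i.e. when d is already the
   solution; the quotients are then 0 and d no longer changes. *)
Definition cg_step (R : realType) (m : nat) (A : 'M[R]_m)
    (s : 'cV[R]_m * 'cV[R]_m * 'cV[R]_m) : 'cV[R]_m * 'cV[R]_m * 'cV[R]_m :=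
  let: (d, r, p) := s in
  let a := dotp r r / dotp p (A *m p) in
  let r' := r - a *: (A *m p) in
  let b := dotp r' r' / dotp r r in
  (d + a *: p, r', r' + b *: p).

Definition cg_iterate (R : realType) (m : nat) (A : 'M[R]_m) (b : 'cV[R]_m)
    (n : nat) : 'cV[R]_m :=
  (iter n (cg_step A) (0, b, b)).1.1.

Definition least (P : nat -> Prop) (n : nat) : Prop :=
  P n /\ forall i, P i -> (n <= i)%N.

(* d is the first CG iterate that meets the termination criterion. *)
Definition cg_direction (R : realType) (m : nat) (tau mu : R)
    (phi : 'cV[R]_m -> R) (eta : R) (x y d : 'cV[R]_m) : Prop :=
  let H := Hmx tau mu phi x y in
  let g := gradient (objective tau mu phi) x in
  exists2 n : nat,
    least (fun i => norm2 (H *m cg_iterate H (- g) i + g) <= eta * norm2 g) n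
    & d = cg_iterate H (- g) n.

Definition dual_step (R : realType) (m : nat) (mu : R)
    (x y d : 'cV[R]_m) : 'cV[R]_m :=
  Dmx mu x *m (1%:M - Dmx mu x *m diagc x *m diagc y) *m d
  - (y - Dmx mu x *m x).

(* p is the Euclidean projection of u onto C. *)
Definition is_projection (R : realType) (m : nat) (C : set 'cV[R]_m)
    (u p : 'cV[R]_m) : Prop :=
  C p /\ forall z, C z -> norm2 (u - p) <= norm2 (u - z).

Definition linf_ball (R : realType) (m : nat) : set 'cV[R]_m :=
  [set y | `|y| <= 1].

Definition backtracking (R : realType) (m : nat) (tau mu : R)
    (phi : 'cV[R]_m -> R) (c2 c3 : R) (x y d : 'cV[R]_m) : nat -> Prop :=
  least (fun j => objective tau mu phi (x + c3 ^+ j *: d)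
    <= objective tau mu phi x
       - c2 * c3 ^+ j * local_norm tau mu phi x y d ^+ 2).

Definition pdNCG_step (R : realType) (m : nat) (tau mu : R)
    (phi : 'cV[R]_m -> R) (eta c2 c3 : R) (x y x' y' : 'cV[R]_m) : Prop :=
  exists (d : 'cV[R]_m) (j : nat),
    [/\ cg_direction tau mu phi eta x y d,
        is_projection (@linf_ball R m) (y + dual_step mu x y d) y',
        backtracking tau mu phi c2 c3 x y d j
      & x' = x + c3 ^+ j *: d].

Definition pdNCG (R : realType) (m : nat) (tau mu : R)
    (phi : 'cV[R]_m -> R) (eta c2 c3 : R) (x y : nat -> 'cV[R]_m) : Prop :=
  linf_ball (y 0%N) /\
  forall k, pdNCG_step tau mu phi eta c2 c3 (x k) (y k) (x k.+1) (y k.+1).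

Definition pd_system (R : realType) (m : nat) (tau mu : R)
    (phi : 'cV[R]_m -> R) (s : 'cV[R]_m * 'cV[R]_m) : Prop :=
  [/\ tau *: s.2 + gradient phi s.1 = 0,
      invmx (Dmx mu s.1) *m s.2 - s.1 = 0
    & linf_ball s.2].

(* Main.v *)
Require Import Defs.
From HB Require Import structures.
From mathcomp Require Import all_boot all_order all_algebra.
From mathcomp Require Import all_classical all_reals all_analysis.
From mathcomp Require Import ring lra.
Import Order.TTheory GRing.Theory Num.Theory.
Import numFieldNormedType.Exports.
Local Open Scope classical_set_scope.
Local Open Scope ring_scope.

(** Because |y_i| <= 1 and D_ii |x_i| < 1, the matrix H(x,y) lies between
    lambda_m I and (lambda_1 + 2 tau / mu) I. Conjugacy of the CG directions
    makes every CG iterate orthogonal to its own residual, so that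
    grad f(x) . d = - d . H d: the CG direction is a descent direction whatever
    eta is, and the termination criterion gives
    (1 - eta) |grad f(x)| <= |H d|. The quadratic upper bound on f (smoothness
    constant L = lambda_1 + tau / mu) bounds the accepted step length below by
    c3 lambda_m / L, so each step decreases f by at least a multiple of |d|^2.
    Strong convexity and the projection bound
    |y^{k+1} - y*| <= 2 |ytilde^{k+1} - y*|, where y* is the limit claimed for
    y^k, then dominate |x^k - x*| and |y^{k+1} - y*| by a multiple of |d^k|,
    which tends to 0 because f(x^k) is nonincreasing and bounded below. *)

Set Implicit Arguments.
Unset Strict Implicit.
Unset Printing Implicit Defensive.

(** * Euclidean inner product, Cauchy-Schwarz and norm bounds *)

Lemma dotpC (R : realType) (m : nat) (u v : 'cV[R]_m) : dotp u v = dotp v u.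
Proof. by apply: eq_bigr => i _; rewrite mulrC. Qed.

Lemma dotpE (R : realType) (m : nat) (u v : 'cV[R]_m) :
  dotp u v = (u^T *m v) 0 0.
Proof. by rewrite mxE; apply: eq_bigr => i _; rewrite mxE. Qed.

Lemma dotpDr (R : realType) (m : nat) (u v w : 'cV[R]_m) :
  dotp u (v + w) = dotp u v + dotp u w.
Proof. by rewrite !dotpE mulmxDr mxE. Qed.

Lemma dotpZr (R : realType) (m : nat) (a : R) (u v : 'cV[R]_m) :
  dotp u (a *: v) = a * dotp u v.
Proof. by rewrite !dotpE -scalemxAr mxE. Qed.

Lemma dotpNr (R : realType) (m : nat) (u v : 'cV[R]_m) :
  dotp u (- v) = - dotp u v.
Proof. by rewrite -scaleN1r dotpZr mulN1r. Qed.

Lemma dotp0r (R : realType) (m : nat) (u : 'cV[R]_m) : dotp u 0 = 0.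
Proof. by rewrite -(scale0r 0) dotpZr mul0r. Qed.

Lemma dotpDl (R : realType) (m : nat) (u v w : 'cV[R]_m) :
  dotp (u + v) w = dotp u w + dotp v w.
Proof. by rewrite dotpC dotpDr !(dotpC w). Qed.

Lemma dotpZl (R : realType) (m : nat) (a : R) (u v : 'cV[R]_m) :
  dotp (a *: u) v = a * dotp u v.
Proof. by rewrite dotpC dotpZr dotpC. Qed.

Lemma dotpNl (R : realType) (m : nat) (u v : 'cV[R]_m) :
  dotp (- u) v = - dotp u v.
Proof. by rewrite dotpC dotpNr dotpC. Qed.

Lemma dotp0l (R : realType) (m : nat) (u : 'cV[R]_m) : dotp 0 u = 0.
Proof. by rewrite dotpC dotp0r. Qed.

Lemma dotp_symmx (R : realType) (m : nat) (A : 'M[R]_m) (u v : 'cV[R]_m) :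
  A^T = A -> dotp u (A *m v) = dotp v (A *m u).
Proof. by move=> AT; rewrite dotpC !dotpE trmx_mul AT mulmxA. Qed.

Lemma dotp_ge0 (R : realType) (m : nat) (v : 'cV[R]_m) : 0 <= dotp v v.
Proof. by apply: sumr_ge0 => i _; rewrite -expr2 sqr_ge0. Qed.

Lemma dotp_eq0 (R : realType) (m : nat) (v : 'cV[R]_m) :
  (dotp v v == 0) = (v == 0).
Proof.
apply/eqP/eqP => [h|->]; last exact: dotp0r.
have h0 (i : 'I_m) : true -> 0 <= v i 0 * v i 0 by rewrite -expr2 sqr_ge0.
apply/matrixP => i j; rewrite ord1 mxE.
have hz := psumr_eq0P h0 h.
have := hz i isT; move/eqP; by rewrite mulf_eq0 orbb => /eqP.
Qed.

Lemma norm2_ge0 (R : realType) (m : nat) (v : 'cV[R]_m) : 0 <= norm2 v.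
Proof. exact: sqrtr_ge0. Qed.

Lemma sqr_norm2 (R : realType) (m : nat) (v : 'cV[R]_m) :
  norm2 v ^+ 2 = dotp v v.
Proof. by rewrite sqr_sqrtr // dotp_ge0. Qed.

Lemma norm2N (R : realType) (m : nat) (v : 'cV[R]_m) : norm2 (- v) = norm2 v.
Proof. by rewrite /norm2 dotpNl dotpNr opprK. Qed.

(** The form at [u + t *: v] is a quadratic polynomial in [t] that is never negative, so its
    discriminant is at most 0. The form may be degenerate, hence a separate case for a zero leading
    coefficient. *)
Lemma psdmx_form_CS (R : realType) (m : nat) (A : 'M[R]_m) (u v : 'cV[R]_m) :
  psdmx A -> dotp u (A *m v) ^+ 2 <= dotp u (A *m u) * dotp v (A *m v).
Proof.
move=> [AT A0].
have q t : 0 <= dotp u (A *m u) + 2 * t * dotp u (A *m v)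
    + t ^+ 2 * dotp v (A *m v).
  have := A0 (u + t *: v).
  rewrite mulmxDr -scalemxAr !dotpDl !dotpDr !dotpZl !dotpZr.
  by rewrite (dotp_symmx v u AT); lra.
move: (A0 u) (A0 v) q.
set a := dotp u _; set b := dotp u _; set c := dotp v _ => a0 c0 q.
have [c_eq0|c_neq0] := eqVneq c 0.
  have [->|b_neq0] := eqVneq b 0; first by rewrite c_eq0; lra.
  (* With [c = 0] the polynomial is affine in [t]; this [t] gives it the value -1. *)
  have := q (- (a + 1) / (2 * b)); rewrite c_eq0 mulr0 addr0.
  have -> : 2 * (- (a + 1) / (2 * b)) * b = - (a + 1) by field.
  lra.
have c_gt0 : 0 < c by rewrite lt_def c_neq0.
(* This is the minimizer of the polynomial. *)
have := q (- b / c).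
have -> : a + 2 * (- b / c) * b + (- b / c) ^+ 2 * c = (a * c - b ^+ 2) / c.
  by field.
by rewrite pmulr_lge0 ?invr_gt0 // subr_ge0.
Qed.

Lemma dotp_CS (R : realType) (m : nat) (u v : 'cV[R]_m) :
  dotp u v <= norm2 u * norm2 v.
Proof.
have p1 : psdmx (1%:M : 'M[R]_m).
  by split=> [|w]; rewrite ?trmx1 // mul1mx dotp_ge0.
have := psdmx_form_CS u v p1; rewrite !mul1mx -!sqr_norm2 -exprMn => h.
apply: le_trans (ler_norm _) _.
by rewrite -(ger0_norm (mulr_ge0 (norm2_ge0 u) (norm2_ge0 v))) -ler_sqr
  ?nnegrE ?normr_ge0 // !real_normK ?num_real.
Qed.

Lemma norm2D (R : realType) (m : nat) (u v : 'cV[R]_m) :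
  norm2 (u + v) <= norm2 u + norm2 v.
Proof.
rewrite -ler_sqr ?nnegrE ?addr_ge0 ?norm2_ge0 // sqr_norm2.
rewrite dotpDl !dotpDr -!sqr_norm2 (dotpC v u).
by have := dotp_CS u v; lra.
Qed.

(** With [w = A *m v], Cauchy-Schwarz for the form of [A] bounds the square of
    [dotp w w = dotp w (A *m v)] by the product of the forms at [w] and [v], hence by
    [L ^+ 2 * dotp w w * dotp v v]; one factor [dotp w w] cancels. *)
Lemma norm2_psdmx_le (R : realType) (m : nat) (A : 'M[R]_m) (L : R)
    (v : 'cV[R]_m) :
  psdmx A -> 0 <= L -> (forall w : 'cV[R]_m, dotp w (A *m w) <= L * dotp w w) ->
  norm2 (A *m v) <= L * norm2 v.
Proof.
move=> pA L0 AL; rewrite -ler_sqr ?nnegrE ?mulr_ge0 ?norm2_ge0 //.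
rewrite exprMn !sqr_norm2; set w := A *m v.
have := psdmx_form_CS w v pA; rewrite -/w.
have [_ A0] := pA.
have := A0 w; have := A0 v; have := AL w; have := AL v; rewrite -/w.
set p := dotp w (A *m w); set q := dotp v w.
have := dotp_ge0 w; have := dotp_ge0 v.
set a := dotp v v; set b := dotp w w => a0 b0 qa pb q0 p0 h.
have h2 : p * q <= (L * b) * (L * a) by apply: ler_pM.
have [->|bn] := eqVneq b 0; first by rewrite mulr_ge0 ?sqr_ge0.
have bp : 0 < b by rewrite lt_def bn.
rewrite -(ler_pM2l bp).
rewrite -expr2; apply: le_trans h (le_trans h2 _).
by rewrite le_eqVlt; apply/orP; left; apply/eqP; ring.
Qed.

Lemma ler_entry_norm2 (R : realType) (m : nat) (v : 'cV[R]_m) (i : 'I_m) :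
  `|v i 0| <= norm2 v.
Proof.
rewrite -ler_sqr ?nnegrE ?norm2_ge0 // sqr_norm2 real_normK ?num_real //.
rewrite /dotp (bigD1 i) //= -expr2 lerDl.
by apply: sumr_ge0 => j _; rewrite -expr2 sqr_ge0.
Qed.

Lemma mx_norm_le_norm2 (R : realType) (m : nat) (v : 'cV[R]_m) :
  `|v| <= norm2 v.
Proof.
rewrite /Num.norm /= mx_normrE; apply: bigmax_le; first exact: norm2_ge0.
by case=> i j _ /=; rewrite ord1 ler_entry_norm2.
Qed.

Lemma linf_ballP (R : realType) (m : nat) (v : 'cV[R]_m) :
  linf_ball v <-> forall i, `|v i 0| <= 1.
Proof.
rewrite /linf_ball /= {1}/Num.norm /= mx_normrE; split=> [h i|h].
  apply: le_trans h.
  by apply: (@le_bigmax _ _ _ _ (fun ij : 'I_m * 'I_1 => `|v ij.1 ij.2|) (i, 0)).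
by apply: bigmax_le => // -[i j] _ /=; rewrite ord1.
Qed.

Lemma norm2_le_entrywise (R : realType) (m : nat) (c : R) (u v : 'cV[R]_m) :
  0 <= c -> (forall i, `|u i 0| <= c * `|v i 0|) -> norm2 u <= c * norm2 v.
Proof.
move=> c0 h; rewrite -ler_sqr ?nnegrE ?mulr_ge0 ?norm2_ge0 //.
rewrite exprMn !sqr_norm2 mulr_sumr; apply: ler_sum => i _.
rewrite -!expr2 -(real_normK (num_real (u i 0))).
rewrite -[X in _ <= _ * X](real_normK (num_real (v i 0))) -exprMn.
by rewrite ler_sqr ?nnegrE ?mulr_ge0.
Qed.

(** * Conjugate gradients: conjugacy and orthogonality *)

(** One induction carries three facts, since each feeds the others: [r i] and [p i] differ by a
    vector orthogonal to [r i], a residual is orthogonal to all earlier directions, and the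
    directions are conjugate. Zero denominators are allowed and must be followed through. *)
Lemma cg_conjugate (R : realType) (m : nat) (A : 'M[R]_m)
    (r p : nat -> 'cV[R]_m) :
  A^T = A -> (forall v : 'cV[R]_m, v != 0 -> 0 < dotp v (A *m v)) ->
  p 0%N = r 0%N ->
  (forall n, r n.+1 = r n
    - (dotp (r n) (r n) / dotp (p n) (A *m p n)) *: (A *m p n)) ->
  (forall n, p n.+1 = r n.+1
    + (dotp (r n.+1) (r n.+1) / dotp (r n) (r n)) *: p n) ->
  forall n, (forall i, (i <= n)%N -> dotp (r i) (p i) = dotp (r i) (r i)) /\
    forall i, (i < n)%N -> dotp (r n) (p i) = 0 /\ dotp (p n) (A *m p i) = 0.
Proof.
move=> AT Apos p0 rS pS.
have r0p0 n : r n = 0 -> p n = 0.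
  case: n => [|n] h; first by rewrite p0.
  by rewrite pS h dotp0l mul0r scale0r addr0.
have q0p0 n : dotp (p n) (A *m p n) = 0 -> p n = 0.
  by move=> h; apply/eqP; apply: contraT => /Apos; rewrite h ltxx.
elim=> [|n [rp IH]].
  by split=> // i; rewrite leqn0 => /eqP ->; rewrite p0.
have rp0 i : (i <= n)%N -> dotp (r n.+1) (p i) = 0.
  rewrite rS dotpDl dotpNl dotpZl leq_eqVlt => /predU1P[->|lin].
    rewrite rp // (dotpC (A *m _)).
    have [q0|q0] := eqVneq (dotp (p n) (A *m p n)) 0; last by field.
    (* A zero denominator forces [p n = 0], and then the numerator vanishes as well. *)
    by rewrite -rp // (q0p0 _ q0) !dotp0r !mul0r subr0.
  by rewrite (IH _ lin).1 (dotpC (A *m _)) (dotp_symmx (p i) _ AT) (IH _ lin).2; ring.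
have rr0 i : (i <= n)%N -> dotp (r n.+1) (r i) = 0.
  case: i => [|i] lin; first by rewrite -p0 rp0.
  have -> : r i.+1
      = p i.+1 - (dotp (r i.+1) (r i.+1) / dotp (r i) (r i)) *: p i.
    by rewrite pS addrK.
  by rewrite dotpDr dotpNr dotpZr !rp0 ?(ltnW lin) // mulr0 subr0.
split=> [i|].
  rewrite leq_eqVlt => /predU1P[->|]; last by rewrite ltnS; exact: rp.
  by rewrite {1}pS dotpDr dotpZr rp0 // mulr0 addr0.
move=> i; rewrite ltnS => lin; split; first exact: rp0.
rewrite pS dotpDl dotpZl.
have [/eqP|ri0] := eqVneq (dotp (r i) (r i)) 0.
  by rewrite dotp_eq0 => /eqP /r0p0 ->; rewrite mulmx0 !dotp0r mulr0 addr0.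
have qi0 : dotp (p i) (A *m p i) != 0.
  apply: contraNneq ri0 => /q0p0 pi0.
  by rewrite -rp // pi0 dotp0r.
(* The step length is now nonzero, so the residual recurrence can be solved for [A *m p i];
   conjugacy reduces to orthogonality of residuals. *)
have Api : A *m p i = (dotp (r i) (r i) / dotp (p i) (A *m p i))^-1
    *: (r i - r i.+1).
  by rewrite rS opprB addrC subrK scalerA mulVf ?scale1r // mulf_neq0 ?invr_eq0.
have rAp : dotp (r n.+1) (A *m p i)
    = (dotp (r i) (r i) / dotp (p i) (A *m p i))^-1
      * (dotp (r n.+1) (r i) - dotp (r n.+1) (r i.+1)).
  by rewrite {1}Api dotpZr dotpDr dotpNr.
(* For [i = n] the coefficient of [p n] in [p n.+1] is exactly the one that cancels; for [i < n]
   every term is zero. *)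
rewrite rAp rr0 //; move: lin; rewrite leq_eqVlt => /predU1P[ein|lin].
  by subst i; field; rewrite ri0 qi0.
by rewrite rr0 // (IH _ lin).2; ring.
Qed.

(** The iterate is a combination of the earlier directions, because CG starts from 0, and the
    residual [b - A *m d] is orthogonal to all of these. *)
Lemma cg_iterate_orthogonal (R : realType) (m : nat) (A : 'M[R]_m)
    (b : 'cV[R]_m) (n : nat) :
  A^T = A -> (forall v : 'cV[R]_m, v != 0 -> 0 < dotp v (A *m v)) ->
  dotp (cg_iterate A b n) (A *m cg_iterate A b n) = dotp (cg_iterate A b n) b.
Proof.
move=> AT Apos.
pose s k := iter k (cg_step A) (0, b, b).
pose d k := (s k).1.1; pose r k := (s k).1.2; pose p k := (s k).2.
pose a k := dotp (r k) (r k) / dotp (p k) (A *m p k).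
have sS k : s k.+1 = (d k + a k *: p k, r k - a k *: (A *m p k),
    r k.+1 + (dotp (r k.+1) (r k.+1) / dotp (r k) (r k)) *: p k).
  by rewrite /a /d /r /p /s /=; case: (iter k _ _) => [[? ?] ?].
have rS k : r k.+1 = r k - a k *: (A *m p k) by rewrite {1}/r sS.
have pS k : p k.+1 = r k.+1
    + (dotp (r k.+1) (r k.+1) / dotp (r k) (r k)) *: p k by rewrite {1}/p sS.
have conj := cg_conjugate AT Apos (erefl : p 0%N = r 0%N) rS pS.
have res k : r k = b - A *m d k.
  elim: k => [|k IH]; first by rewrite mulmx0 subr0.
  by rewrite rS {1}IH /d sS /= mulmxDr -scalemxAr opprD addrA.
have orth v k : (forall i, (i < k)%N -> dotp v (p i) = 0) -> dotp v (d k) = 0.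
  elim: k => [|k IH] h; first exact: dotp0r.
  rewrite /d sS /= dotpDr dotpZr h // mulr0 addr0 IH // => i lik.
  by apply: h; rewrite ltnS ltnW.
have := orth (r n) n (fun i lin => ((conj n).2 i lin).1).
rewrite res dotpDl dotpNl dotpC (dotpC (A *m _)) -[d n]/(cg_iterate A b n).
by move/eqP; rewrite subr_eq0 => /eqP.
Qed.

(** * The scalar function [Num.sqrt (mu ^+ 2 + a ^+ 2)] *)

Lemma sqrt_sqrD_gt0 (R : realType) (mu a : R) :
  0 < mu -> 0 < Num.sqrt (mu ^+ 2 + a ^+ 2).
Proof. by move=> mu0; rewrite sqrtr_gt0 ltr_pwDl ?exprn_gt0 ?sqr_ge0. Qed.

Lemma sqr_sqrt_sqrD (R : realType) (mu a : R) :
  Num.sqrt (mu ^+ 2 + a ^+ 2) ^+ 2 = mu ^+ 2 + a ^+ 2.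
Proof. by rewrite sqr_sqrtr // addr_ge0 ?sqr_ge0. Qed.

Lemma ler_sqrt_sqrDl (R : realType) (mu a : R) :
  0 < mu -> mu <= Num.sqrt (mu ^+ 2 + a ^+ 2).
Proof.
move=> mu0; rewrite -ler_sqr ?nnegrE ?sqrtr_ge0 ?(ltW mu0) //.
by rewrite sqr_sqrt_sqrD lerDl sqr_ge0.
Qed.

Lemma ler_norm_sqrt_sqrDr (R : realType) (mu a : R) :
  `|a| <= Num.sqrt (mu ^+ 2 + a ^+ 2).
Proof.
rewrite -ler_sqr ?nnegrE ?sqrtr_ge0 //.
by rewrite sqr_sqrt_sqrD real_normK ?num_real // lerDr sqr_ge0.
Qed.

(** Cauchy-Schwarz in the plane for the vectors ([mu], [a]) and ([mu], [b]), by Lagrange's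
    identity. *)
Lemma ler_sqrt_sqrD_prod (R : realType) (mu a b : R) :
  mu ^+ 2 + a * b <= Num.sqrt (mu ^+ 2 + a ^+ 2) * Num.sqrt (mu ^+ 2 + b ^+ 2).
Proof.
apply: le_trans (ler_norm _) _.
rewrite -ler_sqr ?nnegrE ?mulr_ge0 ?sqrtr_ge0 // exprMn !sqr_sqrt_sqrD.
rewrite real_normK ?num_real // -subr_ge0.
have -> : (mu ^+ 2 + a ^+ 2) * (mu ^+ 2 + b ^+ 2) - (mu ^+ 2 + a * b) ^+ 2
  = (mu * (a - b)) ^+ 2 by ring.
exact: sqr_ge0.
Qed.

(** With [sa] in place of [mu] in the last denominator, the two sides differ by exactly
    [(sa - sb) ^+ 2 / (2 * sa)]; then [mu <= sa] finishes. *)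
Lemma sqrt_sqrD_quad_upper (R : realType) (mu a b : R) : 0 < mu ->
  Num.sqrt (mu ^+ 2 + b ^+ 2) <= Num.sqrt (mu ^+ 2 + a ^+ 2)
    + (Num.sqrt (mu ^+ 2 + a ^+ 2))^-1 * a * (b - a) + (b - a) ^+ 2 / (2 * mu).
Proof.
move=> mu0; have := sqr_sqrt_sqrD mu a; have := sqr_sqrt_sqrD mu b.
have := ler_sqrt_sqrDl a mu0; have := sqrt_sqrD_gt0 a mu0.
set sa := Num.sqrt (mu ^+ 2 + a ^+ 2); set sb := Num.sqrt (mu ^+ 2 + b ^+ 2).
move=> sa0 musa hb ha.
have h1 : (b - a) ^+ 2 / (2 * sa) <= (b - a) ^+ 2 / (2 * mu).
  by rewrite ler_wpM2l ?sqr_ge0 // lef_pV2 ?posrE ?mulr_gt0 // ler_pM2l.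
rewrite -subr_ge0; apply: le_trans (_ : 0 <= (sa - sb) ^+ 2 / (2 * sa)) _.
  by rewrite mulr_ge0 ?sqr_ge0 // invr_ge0 mulr_ge0 // ltW.
suff : (sa - sb) ^+ 2 / (2 * sa)
    = sa + sa^-1 * a * (b - a) + (b - a) ^+ 2 / (2 * sa) - sb by lra.
have -> : (sa - sb) ^+ 2 = 2 * sa ^+ 2 - 2 * sa * sb + (sb ^+ 2 - sa ^+ 2).
  by ring.
by rewrite hb {2}ha; field; rewrite gt_eqF.
Qed.

(** Convexity: after multiplication by the root at [a], this is the product bound above. *)
Lemma sqrt_sqrD_tangent (R : realType) (mu a b : R) : 0 < mu ->
  Num.sqrt (mu ^+ 2 + a ^+ 2) + (Num.sqrt (mu ^+ 2 + a ^+ 2))^-1 * a * (b - a)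
    <= Num.sqrt (mu ^+ 2 + b ^+ 2).
Proof.
move=> mu0; have sa0 := sqrt_sqrD_gt0 a mu0.
have h := ler_sqrt_sqrD_prod mu a b; have ha := sqr_sqrt_sqrD mu a.
move: sa0 h ha; set sa := Num.sqrt (mu ^+ 2 + a ^+ 2).
set sb := Num.sqrt _ => sa0 h ha.
rewrite -(ler_pM2l sa0).
have -> : sa * (sa + sa^-1 * a * (b - a)) = sa ^+ 2 + a * (b - a).
  by field; rewrite gt_eqF.
by rewrite ha; lra.
Qed.

Lemma sqrt_sqrD_lipschitz (R : realType) (mu a b : R) :
  `|Num.sqrt (mu ^+ 2 + b ^+ 2) - Num.sqrt (mu ^+ 2 + a ^+ 2)| <= `|b - a|.
Proof.
rewrite -ler_sqr ?nnegrE // !real_normK ?num_real //.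
have := ler_sqrt_sqrD_prod mu a b.
have := sqr_sqrt_sqrD mu a; have := sqr_sqrt_sqrD mu b; lra.
Qed.

Lemma div_sqrt_sqrD_lipschitz (R : realType) (mu a b : R) : 0 < mu ->
  `|(Num.sqrt (mu ^+ 2 + b ^+ 2))^-1 * b - (Num.sqrt (mu ^+ 2 + a ^+ 2))^-1 * a|
    <= 2 / mu * `|b - a|.
Proof.
move=> mu0.
have sa0 := sqrt_sqrD_gt0 a mu0; have sb0 := sqrt_sqrD_gt0 b mu0.
have musb := ler_sqrt_sqrDl b mu0; have asa := ler_norm_sqrt_sqrDr mu a.
have lip := sqrt_sqrD_lipschitz mu a b.
move: sa0 sb0 musb asa lip; set sa := Num.sqrt (mu ^+ 2 + a ^+ 2).
set sb := Num.sqrt _ => sa0 sb0 musb asa lip.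
(* The prefactor is at most [mu^-1], and each of the two terms in the bracket is at most [|b - a|];
   hence the constant [2 / mu]. *)
have -> : sb^-1 * b - sa^-1 * a = sb^-1 * ((b - a) - sa^-1 * a * (sb - sa)).
  by field; rewrite !gt_eqF.
have h1 : `|sa^-1 * a| <= 1.
  by rewrite normrM normfV (gtr0_norm sa0) ler_pdivrMl // mulr1.
have h2 : `|(b - a) - sa^-1 * a * (sb - sa)| <= 2 * `|b - a|.
  apply: le_trans (ler_normB _ _) _.
  have : `|sa^-1 * a * (sb - sa)| <= 1 * `|b - a|.
    by rewrite normrM ler_pM.
  lra.
rewrite normrM normfV (gtr0_norm sb0) [leRHS]mulrAC [leRHS]mulrC.
by apply: ler_pM => //; [rewrite invr_ge0 ltW | rewrite lef_pV2 ?posrE].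
Qed.

(** * Diagonal matrices and bounds on [Hmx] *)

Lemma Dmx_mul_entry (R : realType) (m : nat) (mu : R) (x v : 'cV[R]_m) (i : 'I_m) :
  (Dmx mu x *m v) i 0 = (Num.sqrt (mu ^+ 2 + x i 0 ^+ 2))^-1 * v i 0.
Proof. by rewrite mul_diag_mx !mxE. Qed.

(** This diagonal matrix occurs both in [Hmx] and in [dual_step], so one bound on its entries serves
    both. *)
Lemma dual_mx_diag (R : realType) (m : nat) (mu : R) (x y : 'cV[R]_m) :
  Dmx mu x *m (1%:M - Dmx mu x *m diagc x *m diagc y)
  = diag_mx (\row_(i < m) ((Num.sqrt (mu ^+ 2 + x i 0 ^+ 2))^-1
      * (1 - (Num.sqrt (mu ^+ 2 + x i 0 ^+ 2))^-1 * x i 0 * y i 0))).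
Proof.
rewrite /Dmx /diagc !mulmx_diag mul_diag_mx.
apply/matrixP => i j; rewrite !mxE.
by case: eqP => [->|_]; rewrite ?mulr1n ?mulr0n ?subr0 ?mulr0.
Qed.

(** The root is at least [|a|] and [|b| <= 1], so the second factor lies in [0, 2]; the first is at
    most [mu^-1]. *)
Lemma dual_weight_bounds (R : realType) (mu a b : R) : 0 < mu -> `|b| <= 1 ->
  0 <= (Num.sqrt (mu ^+ 2 + a ^+ 2))^-1
      * (1 - (Num.sqrt (mu ^+ 2 + a ^+ 2))^-1 * a * b) <= 2 / mu.
Proof.
move=> mu0 b1.
have sa0 := sqrt_sqrD_gt0 a mu0; have musa := ler_sqrt_sqrDl a mu0.
have asa := ler_norm_sqrt_sqrDr mu a.
move: sa0 musa asa; set s := Num.sqrt _ => sa0 musa asa.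
have h1 : `|s^-1 * a * b| <= 1.
  rewrite normrM mulr_ile1 // normrM normfV (gtr0_norm sa0).
  by rewrite ler_pdivrMl // mulr1.
move: h1; rewrite ler_norml => /andP[h1 h2].
apply/andP; split; first by apply: mulr_ge0; [rewrite invr_ge0 ltW | lra].
rewrite [leRHS]mulrC; apply: ler_pM; [by rewrite invr_ge0 ltW | lra | | lra].
by rewrite lef_pV2 ?posrE.
Qed.

Lemma dotp_diag_bounds (R : realType) (m : nat) (c : R) (w : 'rV[R]_m)
    (v : 'cV[R]_m) : (forall i, 0 <= w 0 i <= c) ->
  0 <= dotp v (diag_mx w *m v) <= c * dotp v v.
Proof.
move=> h; rewrite mul_diag_mx; apply/andP; split.
  apply: sumr_ge0 => i _; rewrite mxE mulrCA mulr_ge0 //.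
    by case/andP: (h i).
  by rewrite -expr2 sqr_ge0.
rewrite mulr_sumr; apply: ler_sum => i _.
rewrite mxE mulrCA ler_wpM2r //; last by case/andP: (h i).
by rewrite -expr2 sqr_ge0.
Qed.

Lemma loewner_le_scalar_l (R : realType) (m : nat) (a : R) (A : 'M[R]_m)
    (v : 'cV[R]_m) : loewner_le a%:M A -> a * dotp v v <= dotp v (A *m v).
Proof.
move=> [_ /(_ v)]; rewrite mulmxBl dotpDr dotpNr mul_scalar_mx dotpZr; lra.
Qed.

Lemma loewner_le_scalar_r (R : realType) (m : nat) (a : R) (A : 'M[R]_m)
    (v : 'cV[R]_m) : loewner_le A a%:M -> dotp v (A *m v) <= a * dotp v v.
Proof.
move=> [_ /(_ v)]; rewrite mulmxBl dotpDr dotpNr mul_scalar_mx dotpZr; lra.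
Qed.

(** [psdmx] contains symmetry; this is the source of the symmetry of the Hessian. *)
Lemma loewner_le_scalar_sym (R : realType) (m : nat) (a : R) (A : 'M[R]_m) :
  loewner_le a%:M A -> A^T = A.
Proof. by move=> [+ _]; rewrite linearB /= tr_scalar_mx => /addIr. Qed.

Lemma Hmx_sym (R : realType) (m : nat) (tau mu a : R) (phi : 'cV[R]_m -> R)
    (x y : 'cV[R]_m) :
  loewner_le a%:M (hessian phi x) -> (Hmx tau mu phi x y)^T = Hmx tau mu phi x y.
Proof.
move=> /loewner_le_scalar_sym hs.
by rewrite /Hmx dual_mx_diag linearD linearZ /= tr_diag_mx hs.
Qed.

Lemma dotp_Hmx_bounds (R : realType) (m : nat) (tau mu a b : R)
    (phi : 'cV[R]_m -> R) (x y v : 'cV[R]_m) :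
  0 < tau -> 0 < mu -> loewner_le a%:M (hessian phi x) ->
  loewner_le (hessian phi x) b%:M -> linf_ball y ->
  a * dotp v v <= dotp v (Hmx tau mu phi x y *m v)
    <= (b + tau * (2 / mu)) * dotp v v.
Proof.
move=> tau0 mu0 /loewner_le_scalar_l ha /loewner_le_scalar_r hb /linf_ballP yB.
rewrite /Hmx dual_mx_diag mulmxDl -scalemxAl dotpDr dotpZr.
set w := \row__ _.
have /(dotp_diag_bounds v) /andP[] : forall i, 0 <= w 0 i <= 2 / mu.
  by move=> i; rewrite mxE dual_weight_bounds.
move: (ha v) (hb v) (dotp_ge0 v).
set q := dotp v (diag_mx w *m v); set d := dotp v v.
move=> h1 h2 d0 q0 q1.
have hq0 : 0 <= tau * q by rewrite mulr_ge0 // ltW.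
have hq1 : tau * q <= tau * (2 / mu * d) by rewrite ler_wpM2l // ltW.
by rewrite mulrDl -(mulrA tau); apply/andP; split; lra.
Qed.

(** * Derivatives along lines and second-order bounds *)

(** The two difference quotients are the same function of the increment. This reduces directional
    derivatives to real functions, where the mean value theorem applies. *)
Lemma is_derive_line (R : realType) (V W : normedModType R) (f : V -> W)
    (x v : V) (t : R) (df : W) :
  is_derive (x + t *: v) v f df <->
  is_derive t 1 (fun s : R => f (x + s *: v)) df.
Proof.
have e : (fun h : R => h^-1 *: ((f \o shift (x + t *: v)) (h *: v)
      - f (x + t *: v)))
    = (fun h : R => h^-1 *: (((fun s : R => f (x + s *: v)) \o shift t) (h *: 1)
      - f (x + t *: v))).
  apply/funext => h /=; congr (_ *: (f _ - _)).
  by rewrite [h *: 1]mulr1 scalerDl addrCA.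
by split=> -[df1 df2]; split; rewrite /derivable /derive ?e // -?e.
Qed.

Lemma derive_basis (R : realType) (m : nat) (W : normedModType R)
    (f : 'cV[R]_m -> W) (x v : 'cV[R]_m) : differentiable f x ->
  'D_v f x = \sum_(i < m) v i 0 *: 'D_(delta_mx i 0 : 'cV[R]_m) f x.
Proof.
move=> df; rewrite deriveE // {1}(matrix_sum_delta v) linear_sum.
by apply: eq_bigr => i _; rewrite big_ord1 linearZ /= deriveE.
Qed.

Lemma is_derive_gradient (R : realType) (m : nat) (g : 'cV[R]_m -> R)
    (x v : 'cV[R]_m) : differentiable g x ->
  is_derive x v g (dotp (gradient g x) v).
Proof.
move=> dg; apply: DeriveDef; first exact: diff_derivable.
by rewrite derive_basis //; apply: eq_bigr => i _; rewrite mxE mulrC.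
Qed.

Lemma is_derive_dotp_gradient (R : realType) (m : nat) (g : 'cV[R]_m -> R)
    (x v : 'cV[R]_m) : differentiable (gradient g) x ->
  is_derive x v (fun z => dotp (gradient g z) v) (dotp v (hessian g x *m v)).
Proof.
move=> dg.
have dgj j : differentiable (fun z => gradient g z j 0) x.
  exact: (differentiable_comp dg (differentiable_coord (gradient g x) j 0)).
have -> : (fun z => dotp (gradient g z) v)
    = \sum_(j < m) (v j 0 \*: (fun z => gradient g z j 0)).
  apply/funext => z; rewrite fct_sumE; apply: eq_bigr => j _.
  by rewrite mulrC.
have -> : dotp v (hessian g x *m v)
    = \sum_(j < m) v j 0 *: 'D_v (fun z => gradient g z j 0) x.
  (* Row [i] of [hessian] differentiates along basis vector [i], so exchanging the sums groups the
     terms into derivatives of gradient entry [j] along [v]. *)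
  transitivity (\sum_(i < m) \sum_(j < m)
      v i 0 * (hessian g x i j * v j 0)).
    by apply: eq_bigr => i _; rewrite mxE mulr_sumr.
  rewrite exchange_big; apply: eq_bigr => j _.
  rewrite derive_basis // scaler_sumr; apply: eq_bigr => i _.
  by rewrite mxE /GRing.scale /=; ring.
apply: is_derive_sum => j; apply: is_deriveZ; apply: derivableP.
exact: diff_derivable.
Qed.

(** The second derivative [w] is only bounded above, perhaps discontinuous, so the mean value
    theorem is applied twice instead of integrating a remainder. *)
Lemma taylor2_upper (R : realType) (h u w : R -> R) (M : R) :
  (forall t : R, is_derive t (1 : R) h (u t)) ->
  (forall t : R, is_derive t (1 : R) u (w t)) ->
  (forall t, w t <= M) -> h 1 <= h 0 + u 0 + M / 2.
Proof.
move=> hu uw wM.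
(* Subtracting the whole quadratic secures the factor 1/2: the derivative of [k] is at most 0 on the
   interval, because [u c - u 0 = w e * c]. *)
pose k t := h t - u 0 * t - M / 2 * t ^+ 2.
have dk (t : R) : is_derive t (1 : R) k (u t - u 0 - M * t).
  have := hu t => hut.
  by apply: is_derive_eq; rewrite /GRing.scale /=; field.
have ck (f df : R -> R) a b : (forall t : R, is_derive t (1 : R) f (df t)) ->
    {within `[a, b], continuous f}.
  by move=> df1; apply: derivable_within_continuous => s _; case: (df1 s).
have [c /[!in_itv] /= /andP[c0 c1]] := MVT ltr01 (fun t _ => dk t) (ck _ _ _ _ dk).
have [e /[!in_itv] /= /andP[e0 ec]] := MVT c0 (fun t _ => uw t) (ck _ _ _ _ uw).
rewrite !subr0 mulr1 /k => hc hk.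
have : w e * c <= M * c by rewrite ler_wpM2r ?wM // ltW.
lra.
Qed.

Lemma hessian_quad_upper (R : realType) (m : nat) (g : 'cV[R]_m -> R) (M : R) :
  twice_differentiable g -> (forall z, loewner_le (hessian g z) M%:M) ->
  forall x d : 'cV[R]_m,
    g (x + d) <= g x + dotp (gradient g x) d + M / 2 * dotp d d.
Proof.
move=> [dg ddg] hM x d.
have h1 (t : R) := (is_derive_line _ _ _ _ _).1 (is_derive_gradient d (dg (x + t *: d))).
have h2 (t : R) :=
  (is_derive_line _ _ _ _ _).1 (is_derive_dotp_gradient d (ddg (x + t *: d))).
have := taylor2_upper h1 h2 (fun t => loewner_le_scalar_r d (hM _)).
by rewrite /= scale1r scale0r addr0; lra.
Qed.

Lemma gradient_strongly_monotone (R : realType) (m : nat) (g : 'cV[R]_m -> R)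
    (a : R) :
  twice_differentiable g -> (forall z, loewner_le a%:M (hessian g z)) ->
  forall x d : 'cV[R]_m,
    a * dotp d d <= dotp (gradient g (x + d)) d - dotp (gradient g x) d.
Proof.
move=> [_ ddg] ha x d.
have h2 (t : R) :=
  (is_derive_line _ _ _ _ _).1 (is_derive_dotp_gradient d (ddg (x + t *: d))).
have [|c _] := MVT ltr01 (fun t _ => h2 t).
  by apply: derivable_within_continuous => s _; case: (h2 s).
rewrite /= scale1r scale0r addr0 subr0 mulr1 => ->.
exact: loewner_le_scalar_l.
Qed.

(** * Gradient, smoothness and strong monotonicity of the objective *)

Lemma is_derive_sqrt_sqrD (R : realType) (mu a : R) : 0 < mu ->
  is_derive a (1 : R) (fun t : R => Num.sqrt (mu ^+ 2 + t ^+ 2))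
    ((Num.sqrt (mu ^+ 2 + a ^+ 2))^-1 * a).
Proof.
move=> mu0.
have h : 0 < mu ^+ 2 + a ^+ 2 by rewrite ltr_pwDl ?exprn_gt0 ?sqr_ge0.
have d1 := is_derive1_sqrt h.
have d2 : is_derive a (1 : R) (fun t : R => mu ^+ 2 + t ^+ 2) (2 * a).
  by apply: is_derive_eq; rewrite /GRing.scale /=; ring.
have := is_derive1_comp (g := fun t : R => mu ^+ 2 + t ^+ 2) d1 d2.
have -> : (2 * Num.sqrt (mu ^+ 2 + a ^+ 2))^-1 * (2 * a)
    = (Num.sqrt (mu ^+ 2 + a ^+ 2))^-1 * a.
  by field; rewrite gt_eqF // sqrt_sqrD_gt0.
by [].
Qed.

Lemma is_derive_psi (R : realType) (m : nat) (mu : R) (x v : 'cV[R]_m) :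
  0 < mu -> is_derive x v (psi mu) (dotp (Dmx mu x *m x) v).
Proof.
(* Writing the point as [x + 0 *: v] lets the restriction to a line be used at parameter 0. *)
move=> mu0; rewrite -[x in is_derive x](addr0 x) -(scale0r v).
apply/is_derive_line.
have -> : (fun s : R => psi mu (x + s *: v)) = \sum_(i < m) (fun s : R =>
    Num.sqrt (mu ^+ 2 + (x i 0 + s * v i 0) ^+ 2) - mu).
  apply/funext => s; rewrite fct_sumE; apply: eq_bigr => i _.
  by rewrite !mxE.
apply: is_derive_sum => i; rewrite Dmx_mul_entry.
have d1 := is_derive_sqrt_sqrD (x i 0 + 0 * v i 0) mu0.
have d2 : is_derive (0 : R) (1 : R) (fun s : R => x i 0 + s * v i 0) (v i 0).
  by apply: is_derive_eq; rewrite /GRing.scale /=; ring.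
have d3 := is_derive1_comp (g := fun s : R => x i 0 + s * v i 0) d1 d2.
rewrite mul0r addr0 in d3.
by apply: is_derive_eq; rewrite subr0.
Qed.

Lemma gradient_objective (R : realType) (m : nat) (tau mu : R)
    (phi : 'cV[R]_m -> R) (x : 'cV[R]_m) : 0 < mu -> differentiable phi x ->
  gradient (objective tau mu phi) x = tau *: (Dmx mu x *m x) + gradient phi x.
Proof.
move=> mu0 dphi; apply/matrixP => i j.
rewrite ord1 [LHS]mxE [RHS]mxE [X in X + _]mxE [X in _ + X]mxE.
have d1 := is_derive_psi x (delta_mx i 0) mu0.
have d2 : derivable phi x (delta_mx i 0) by exact: diff_derivable.
have := is_deriveD (is_deriveZ tau d1) (derivableP d2).
case=> _ ->; congr (_ * _ + _).
rewrite /dotp (bigD1 i) //= big1 => [|k ki].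
  by rewrite !mxE !eqxx mulr1 addr0.
by rewrite [X in _ * X]mxE (negbTE ki) mulr0.
Qed.

Lemma psi_upper (R : realType) (m : nat) (mu : R) (x d : 'cV[R]_m) : 0 < mu ->
  psi mu (x + d) <= psi mu x + dotp (Dmx mu x *m x) d + dotp d d / (2 * mu).
Proof.
move=> mu0; rewrite /psi /dotp mulr_suml -!big_split; apply: ler_sum => i _.
rewrite Dmx_mul_entry [(x + d) i 0]mxE /=.
have := sqrt_sqrD_quad_upper (x i 0) (x i 0 + d i 0) mu0.
rewrite (_ : x i 0 + d i 0 - x i 0 = d i 0); last by ring.
by rewrite -expr2 => h; lra.
Qed.

Lemma psi_gradient_monotone (R : realType) (m : nat) (mu : R)
    (x d : 'cV[R]_m) : 0 < mu ->
  dotp (Dmx mu x *m x) d <= dotp (Dmx mu (x + d) *m (x + d)) d.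
Proof.
move=> mu0; apply: ler_sum => i _; rewrite !Dmx_mul_entry [(x + d) i 0]mxE.
(* Adding the tangent inequalities at both endpoints gives monotonicity of the derivative. *)
have := sqrt_sqrD_tangent (x i 0) (x i 0 + d i 0) mu0.
have := sqrt_sqrD_tangent (x i 0 + d i 0) (x i 0) mu0.
rewrite (_ : x i 0 + d i 0 - x i 0 = d i 0); last by ring.
rewrite (_ : x i 0 - (x i 0 + d i 0) = - d i 0); last by ring.
lra.
Qed.

Lemma objective_quad_upper (R : realType) (m : nat) (tau mu b : R)
    (phi : 'cV[R]_m -> R) : 0 < tau -> 0 < mu -> twice_differentiable phi ->
  (forall z, loewner_le (hessian phi z) b%:M) ->
  forall x d : 'cV[R]_m,
    objective tau mu phi (x + d) <= objective tau mu phi x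
      + dotp (gradient (objective tau mu phi) x) d
      + (b + tau / mu) / 2 * dotp d d.
Proof.
move=> tau0 mu0 dphi hb x d.
rewrite gradient_objective //; last exact: dphi.1.
have h1 := hessian_quad_upper dphi hb x d.
have := psi_upper x d mu0; rewrite -(ler_pM2l tau0) => h2.
rewrite /objective dotpDl dotpZl.
have -> : (b + tau / mu) / 2 * dotp d d
    = b / 2 * dotp d d + tau * (dotp d d / (2 * mu)).
  by field; rewrite gt_eqF.
lra.
Qed.

Lemma objective_strongly_monotone (R : realType) (m : nat) (tau mu a : R)
    (phi : 'cV[R]_m -> R) : 0 < tau -> 0 < mu -> twice_differentiable phi ->
  (forall z, loewner_le a%:M (hessian phi z)) ->
  forall x d : 'cV[R]_m, a * dotp d d
    <= dotp (gradient (objective tau mu phi) (x + d)) d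
      - dotp (gradient (objective tau mu phi) x) d.
Proof.
move=> tau0 mu0 dphi ha x d.
rewrite !gradient_objective //; [|exact: dphi.1..].
have h1 := gradient_strongly_monotone dphi ha x d.
have := psi_gradient_monotone x d mu0; rewrite -(ler_pM2l tau0) => h2.
rewrite !dotpDl !dotpZl; lra.
Qed.

(** * Error bound, stationarity and step length *)

(** Strong monotonicity between [xs] and [x], then Cauchy-Schwarz; one factor [norm2 (x - xs)]
    cancels. *)
Lemma objective_dist_minimizer (R : realType) (m : nat) (tau mu a : R)
    (phi : 'cV[R]_m -> R) : 0 < tau -> 0 < mu -> twice_differentiable phi ->
  0 < a -> (forall z, loewner_le a%:M (hessian phi z)) ->
  forall xs x : 'cV[R]_m, gradient (objective tau mu phi) xs = 0 ->
    a * norm2 (x - xs) <= norm2 (gradient (objective tau mu phi) x).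
Proof.
move=> tau0 mu0 dphi a0 ha xs x g0.
have := objective_strongly_monotone tau0 mu0 dphi ha xs (x - xs).
rewrite g0 dotp0l subr0 subrKC -sqr_norm2 => h.
move: (le_trans h (dotp_CS _ _)) => {}h.
have [->|n0] := eqVneq (norm2 (x - xs)) 0; first by rewrite mulr0 norm2_ge0.
by move: h; rewrite expr2 mulrA ler_pM2r // lt_def n0 norm2_ge0.
Qed.

(** The step [- (2 * M)^-1 *: g] minimizes the quadratic upper bound and would decrease [f] by at
    least [(4 * M)^-1 * dotp g g]. *)
Lemma minimizer_gradient0 (R : realType) (m : nat) (f : 'cV[R]_m -> R)
    (M : R) (x g : 'cV[R]_m) : 0 < M ->
  (forall d, f (x + d) <= f x + dotp g d + M * dotp d d) ->
  (forall z, f x <= f z) -> g = 0.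
Proof.
move=> M0 up min.
have := le_trans (min _) (up (- (2 * M)^-1 *: g)).
rewrite !dotpZr dotpZl => h.
apply/eqP; rewrite -dotp_eq0 eq_le dotp_ge0 andbT.
have e : - (2 * M)^-1 * dotp g g
    + M * (- (2 * M)^-1 * (- (2 * M)^-1 * dotp g g)) = - (4 * M)^-1 * dotp g g.
  by field; rewrite gt_eqF.
have : 0 <= - (4 * M)^-1 * dotp g g by lra.
by rewrite mulNr oppr_ge0 pmulr_rle0 // invr_gt0 mulr_gt0.
Qed.

(* A rejected step length t satisfies t > a / L, because the upper bound on F
   forces sufficient decrease for every t <= a / L. *)
Lemma backtracking_step_ge (R : realType) (c2 c3 a L fx q N : R) (j : nat)
    (F : R -> R) :
  0 < c2 < 1 / 2 -> 0 < c3 < 1 -> 0 < a <= L ->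
  0 <= q -> a * q <= N ->
  (forall t, F t <= fx - t * N + L / 2 * (t ^+ 2 * q)) ->
  least (fun i => F (c3 ^+ i) <= fx - c2 * c3 ^+ i * N) j ->
  c3 * (a / L) <= c3 ^+ j.
Proof.
move=> /andP[c20 c2h] /andP[c30 c31] /andP[a0 aL] q0 aqN up [_ jmin].
have L0 : 0 < L := lt_le_trans a0 aL.
case: j jmin => [|j] jmin.
  by rewrite expr0 mulr_ile1 ?divr_ge0 ?ler_pdivrMr ?mul1r // ltW.
rewrite exprS ler_pM2l // leNgt; apply/negP => lt_t.
suff /jmin : F (c3 ^+ j) <= fx - c2 * c3 ^+ j * N by rewrite ltnn.
apply: le_trans (up _) _.
set t := c3 ^+ j in lt_t *; have t0 : 0 < t by rewrite exprn_gt0.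
have tL : t * L <= a by rewrite -ler_pdivlMr // ltW.
have h1 : t * L * (t * q) <= a * (t * q).
  by rewrite ler_wpM2r // mulr_ge0 // ltW.
have h2 : t * (a * q) <= t * N by rewrite ler_wpM2l // ltW.
(* By [h1] and [h2] the quadratic term costs at most half of [t * N]; [c2 < 1 / 2] leaves the
   required decrease. *)
have h3 : 0 <= (1 / 2 - c2) * (t * N).
  rewrite mulr_ge0 ?subr_ge0 ?(ltW c2h) //; apply: le_trans h2.
  by rewrite !mulr_ge0 // ltW.
lra.
Qed.

(** * Estimates for one pdNCG step *)

(** The direction [d] is exposed because the dual update, the decrease and the gradient are all to
    be compared through it. The decrease constant multiplies [c2], the lower bound on the step
    length, and the factor [a] of [a * dotp d d <= dotp d (H *m d)]. *)
Lemma pdNCG_step_decrease (R : realType) (m : nat) (tau mu a b eta c2 c3 : R)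
    (phi : 'cV[R]_m -> R) (x y x' y' : 'cV[R]_m) :
  0 < tau -> 0 < mu -> twice_differentiable phi -> 0 < a -> a <= b ->
  (forall z, loewner_le a%:M (hessian phi z)) ->
  (forall z, loewner_le (hessian phi z) b%:M) ->
  0 < c2 < 1 / 2 -> 0 < c3 < 1 -> 0 <= eta < 1 -> linf_ball y ->
  pdNCG_step tau mu phi eta c2 c3 x y x' y' ->
  exists d : 'cV[R]_m,
    [/\ is_projection (@linf_ball R m) (y + dual_step mu x y d) y',
        c2 * (c3 * (a / (b + tau / mu))) * a * dotp d d
          <= objective tau mu phi x - objective tau mu phi x'
      & norm2 (gradient (objective tau mu phi) x)
          <= (b + tau * (2 / mu)) / (1 - eta) * norm2 d].
Proof.
move=> tau0 mu0 dphi a0 ab ha hb hc2 hc3 /andP[eta0 eta1] yB.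
move=> [d [j [[n [cgstop _] dE] proj ls ->]]]; exists d.
have HT := Hmx_sym tau mu y (ha x).
have Hb v := andP (dotp_Hmx_bounds v tau0 mu0 (ha x) (hb x) yB).
have Hpos v : v != 0 -> 0 < dotp v (Hmx tau mu phi x y *m v).
  move=> v0; apply: lt_le_trans (Hb v).1; rewrite mulr_gt0 //.
  by rewrite lt_def dotp_eq0 v0 dotp_ge0.
have Hge0 v : 0 <= dotp v (Hmx tau mu phi x y *m v).
  by apply: le_trans (Hb v).1; rewrite mulr_ge0 ?dotp_ge0 // ltW.
split=> //.
- have := cg_iterate_orthogonal (- gradient (objective tau mu phi) x) n HT Hpos.
  rewrite -dE dotpNr (dotpC d (gradient _ _)) => hN.
  have lnE : local_norm tau mu phi x y d ^+ 2
      = dotp d (Hmx tau mu phi x y *m d) by rewrite sqr_sqrtr.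
  rewrite /backtracking lnE in ls.
  have := (Hb d).1; have := Hge0 d; set N := dotp d (_ *m _) in hN ls *.
  move=> N0 aqN.
  have up t : objective tau mu phi (x + t *: d) <= objective tau mu phi x
      - t * N + (b + tau / mu) / 2 * (t ^+ 2 * dotp d d).
    apply: le_trans (objective_quad_upper tau0 mu0 dphi hb x (t *: d)) _.
    by rewrite !dotpZr dotpZl hN; lra.
  have aL : 0 < a <= b + tau / mu.
    by rewrite a0 /= (le_trans ab) // lerDl divr_ge0 // ltW.
  have step := backtracking_step_ge hc2 hc3 aL (dotp_ge0 d) aqN up ls.
  case: ls => ls _; case/andP: hc2 => c20 _; case/andP: hc3 => c30 _.
  have : c3 * (a / (b + tau / mu)) * (a * dotp d d) <= c3 ^+ j * N.
    apply: ler_pM => //; last by rewrite mulr_ge0 ?dotp_ge0 // ltW.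
    case/andP: aL => _ aL.
    by rewrite mulr_ge0 ?divr_ge0 ?(ltW c30) ?(ltW a0) ?(le_trans (ltW a0) aL).
  rewrite -(ler_pM2l c20); move: ls; lra.
- set g := gradient _ _ in cgstop *; set H := Hmx _ _ _ _ _ in HT Hb Hge0 cgstop.
  have L0 : 0 <= b + tau * (2 / mu).
    rewrite addr_ge0 ?mulr_ge0 ?invr_ge0 ?(ltW mu0) ?(ltW tau0) //.
    exact: le_trans (ltW a0) ab.
  have := norm2_psdmx_le d (conj HT Hge0) L0 (fun w => (Hb w).2).
  rewrite mulrAC ler_pdivlMr ?subr_gt0 //.
  (* [g] is the CG residual minus [H *m d]; the term [eta * norm2 g] moves to the left, which is
     where [eta < 1] enters. *)
  have := norm2D (H *m d + g) (- (H *m d)).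
  rewrite norm2N addrAC subrr add0r; move: cgstop; rewrite -dE; lra.
Qed.

(** [z] competes with [p] in the projection problem, so the triangle inequality through [u] costs a
    factor 2. *)
Lemma projection_dist (R : realType) (m : nat) (C : set 'cV[R]_m)
    (u p z : 'cV[R]_m) :
  is_projection C u p -> C z -> norm2 (p - z) <= 2 * norm2 (u - z).
Proof.
move=> [_ h] /h {}h; have := norm2D (- (u - p)) (u - z).
by rewrite norm2N opprB addrA subrK; lra.
Qed.

Lemma dual_point_lipschitz (R : realType) (m : nat) (mu : R)
    (x z : 'cV[R]_m) : 0 < mu ->
  norm2 (Dmx mu x *m x - Dmx mu z *m z) <= 2 / mu * norm2 (x - z).
Proof.
move=> mu0; apply: norm2_le_entrywise => [|i].
  by rewrite divr_ge0 // ltW.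
rewrite [X in `|X| <= _]mxE [X in `|_ + X| <= _]mxE !Dmx_mul_entry.
by rewrite [(x - z) i 0]mxE [(- z) i 0]mxE div_sqrt_sqrD_lipschitz.
Qed.

Lemma dual_point_linf_ball (R : realType) (m : nat) (mu : R) (x : 'cV[R]_m) :
  0 < mu -> linf_ball (Dmx mu x *m x).
Proof.
move=> mu0; apply/linf_ballP => i; rewrite Dmx_mul_entry.
have s0 := sqrt_sqrD_gt0 (x i 0) mu0.
by rewrite normrM normfV (gtr0_norm s0) ler_pdivrMl // mulr1
  ler_norm_sqrt_sqrDr.
Qed.

(** The additive [y] cancels: the updated dual point is a bounded diagonal matrix times [d], plus
    [Dmx mu x *m x]. The previous dual error is therefore not inherited. *)
Lemma dual_step_dist (R : realType) (m : nat) (mu : R) (x y d z : 'cV[R]_m) :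
  0 < mu -> linf_ball y ->
  norm2 (y + dual_step mu x y d - Dmx mu z *m z)
    <= 2 / mu * (norm2 d + norm2 (x - z)).
Proof.
move=> mu0 /linf_ballP yB; rewrite mulrDr.
have -> : y + dual_step mu x y d - Dmx mu z *m z
    = Dmx mu x *m (1%:M - Dmx mu x *m diagc x *m diagc y) *m d
      + (Dmx mu x *m x - Dmx mu z *m z).
  by rewrite /dual_step opprB addrCA subrKC addrA.
apply: le_trans (norm2D _ _) (lerD _ (dual_point_lipschitz _ _ mu0)).
apply: norm2_le_entrywise => [|i]; first by rewrite divr_ge0 // ltW.
rewrite dual_mx_diag mul_diag_mx [X in `|X|]mxE [X in X * _]mxE.
have /andP[w0 w1] := dual_weight_bounds (x i 0) mu0 (yB i).
by rewrite normrM (ger0_norm w0) ler_wpM2r.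
Qed.

(** * Convergence of the iterates *)

(** A nonincreasing sequence bounded below converges, so its successive differences tend to 0. *)
Lemma cvg_norm2_sqr_decrease (R : realType) (m : nat) (u : nat -> 'cV[R]_m)
    (l : 'cV[R]_m) (e : nat -> R) (b K : R) :
  (forall k, e k.+1 <= e k) -> (forall k, b <= e k) ->
  (forall k, norm2 (u k - l) ^+ 2 <= K * (e k - e k.+1)) ->
  u @ \oo --> l.
Proof.
move=> e_dec e_lb hu.
have ce : cvgn e.
  apply: nonincreasing_is_cvgn; last by exists b => _ [k _ <-].
  by apply/nonincreasing_seqP.
have cde : (fun k => K * (e k - e k.+1)) @ \oo --> (0 : R).
  rewrite -(mulr0 K) -(subrr (limn e)); apply: cvgM; first exact: cvg_cst.
  by apply: cvgB => //; rewrite cvg_shiftS.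
apply/cvgrPdist_lt => eps eps0.
have eps2 : 0 < eps ^+ 2 by rewrite exprn_gt0.
near=> k.
have hk : K * (e k - e k.+1) < eps ^+ 2.
  by near: k; exact: (cvgr_lt _ cde _ eps2).
(* Convergence is in the maximum norm, which the Euclidean norm dominates. *)
rewrite distrC; apply: le_lt_trans (mx_norm_le_norm2 _) _.
rewrite -ltr_sqr ?nnegrE ?norm2_ge0 ?(ltW eps0) //.
exact: le_lt_trans (hu k) hk.
Unshelve. all: by end_near.
Qed.

Lemma pdNCG_linf_ball (R : realType) (m : nat) (tau mu : R)
    (phi : 'cV[R]_m -> R) (eta c2 c3 : R) (x y : nat -> 'cV[R]_m) :
  pdNCG tau mu phi eta c2 c3 x y -> forall k, linf_ball (y k).
Proof. by move=> [y0 st] [|k] //; have [d [j [_ [? _] _ _]]] := st k. Qed.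

Lemma pdNCG_cvg (R : realType) (m : nat) (tau mu a b eta c2 c3 : R)
    (phi : 'cV[R]_m -> R) (x y : nat -> 'cV[R]_m) (xs : 'cV[R]_m) :
  0 < tau -> 0 < mu -> twice_differentiable phi -> 0 < a -> a <= b ->
  (forall z, loewner_le a%:M (hessian phi z)) ->
  (forall z, loewner_le (hessian phi z) b%:M) ->
  0 < c2 < 1 / 2 -> 0 < c3 < 1 -> 0 <= eta < 1 ->
  pdNCG tau mu phi eta c2 c3 x y ->
  (forall z, objective tau mu phi xs <= objective tau mu phi z) ->
  gradient (objective tau mu phi) xs = 0 ->
  x @ \oo --> xs /\ y @ \oo --> Dmx mu xs *m xs.
Proof.
move=> tau0 mu0 dphi a0 ab ha hb hc2 hc3 heta hxy hmin g0.
pose e k := objective tau mu phi (x k).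
pose C := c2 * (c3 * (a / (b + tau / mu))) * a.
pose K := (b + tau * (2 / mu)) / (1 - eta).
have C0 : 0 < C.
  case/andP: hc2 => c20 _; case/andP: hc3 => c30 _.
  have b0 : 0 < b := lt_le_trans a0 ab.
  by rewrite !mulr_gt0 ?invr_gt0 ?addr_gt0 ?mulr_gt0 ?invr_gt0.
have step k : exists d : 'cV[R]_m, [/\ norm2 d ^+ 2 <= C^-1 * (e k - e k.+1),
    norm2 (x k - xs) <= K / a * norm2 d &
    (* The constant collects 2 from the projection, [2 / mu] from the dual step, and [1 + K / a]
       from [norm2 d + norm2 (x k - xs)]. *)
    norm2 (y k.+1 - Dmx mu xs *m xs)
      <= 2 * (2 / mu * (1 + K / a)) * norm2 d].
  have yB := pdNCG_linf_ball hxy k.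
  have [d [proj dec gd]] := pdNCG_step_decrease tau0 mu0 dphi a0 ab ha hb hc2
    hc3 heta yB (hxy.2 k).
  have hx : norm2 (x k - xs) <= K / a * norm2 d.
    rewrite mulrAC ler_pdivlMr // mulrC; apply: le_trans gd.
    exact: objective_dist_minimizer.
  exists d; split=> //; first by rewrite sqr_norm2 ler_pdivlMl.
  apply: le_trans (projection_dist proj (dual_point_linf_ball xs mu0)) _.
  rewrite -[leRHS]mulrA ler_pM2l //.
  apply: le_trans (dual_step_dist _ _ _ mu0 yB) _.
  rewrite -[leRHS]mulrA ler_pM2l ?divr_gt0 //; lra.
have decr (u : nat -> 'cV[R]_m) l M :
    (forall k, exists d : 'cV[R]_m, norm2 d ^+ 2 <= C^-1 * (e k - e k.+1)
      /\ norm2 (u k - l) <= M * norm2 d) -> u @ \oo --> l.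
  move=> h; apply: (@cvg_norm2_sqr_decrease _ _ _ _ e
    (objective tau mu phi xs) (M ^+ 2 * C^-1)) => [k|k|k]; last first.
  - have [d [hd hu]] := h k; rewrite -mulrA.
    apply: le_trans (_ : (M * norm2 d) ^+ 2 <= _).
      rewrite ler_sqr ?nnegrE ?norm2_ge0 //.
      exact: le_trans (norm2_ge0 _) hu.
    by rewrite exprMn ler_wpM2l ?sqr_ge0.
  - exact: hmin.
  - have [d [hd _]] := h k.
    have := le_trans (sqr_ge0 _) hd.
    by rewrite pmulr_rge0 ?invr_gt0 // subr_ge0.
split.
  by apply: (decr _ _ (K / a)) => k; have [d []] := step k; exists d.
(* Step [k] controls the dual iterate of index [k.+1], hence the shift. *)
rewrite -cvg_shiftS; apply: (decr _ _ (2 * (2 / mu * (1 + K / a)))) => k.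
by have [d []] := step k; exists d.
Qed.

(** * The primal-dual system and the final result *)

(** [Dmx mu x] is invertible, so the second equation determines [y], and substitution turns the
    first into stationarity of the objective. *)
Lemma pd_systemP (R : realType) (m : nat) (tau mu : R)
    (phi : 'cV[R]_m -> R) (x y : 'cV[R]_m) : 0 < mu -> differentiable phi x ->
  pd_system tau mu phi (x, y) <->
  y = Dmx mu x *m x /\ gradient (objective tau mu phi) x = 0.
Proof.
move=> mu0 dphi; rewrite gradient_objective //.
have uD : Dmx mu x \in unitmx.
  rewrite unitmxE det_diag unitfE; apply/prodf_neq0 => i _.
  by rewrite mxE invr_eq0 gt_eqF // sqrt_sqrD_gt0.
split=> [[/= h1 /eqP h2 _]|[-> h]].
  suff e : y = Dmx mu x *m x by rewrite -e.
  by move: h2; rewrite subr_eq0 => /eqP h2; rewrite -{2}h2 mulKVmx.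
by split => //=; [rewrite mulKmx // subrr | exact: dual_point_linf_ball].
Qed.

Unset Implicit Arguments.

Theorem theorem2 (R : realType) (m : nat) (tau mu : R)
    (phi : 'cV[R]_m -> R) (lambda_m lambda_1 Lphi : R)
    (eta c2 c3 : R) (x y : nat -> 'cV[R]_m) (xstar : 'cV[R]_m)
    (htau : 0 < tau) (hmu : 0 < mu)
    (hphi : twice_differentiable phi)
    (hlambda_m : 0 < lambda_m) (hlambda : lambda_m <= lambda_1)
    (hlower : forall z, loewner_le (lambda_m%:M) (hessian phi z))
    (hupper : forall z, loewner_le (hessian phi z) (lambda_1%:M))
    (hLphi : 0 <= Lphi)
    (hlip : forall z w,
      spectral_norm (hessian phi w - hessian phi z) <= Lphi * norm2 (w - z))
    (hc2 : 0 < c2 < 1 / 2) (hc3 : 0 < c3 < 1)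
    (heta : 0 <= eta < 1)
    (hxy : pdNCG tau mu phi eta c2 c3 x y)
    (hxstar : forall z,
      objective tau mu phi xstar <= objective tau mu phi z) :
  (y @ \oo --> Dmx mu xstar *m xstar) /\
  (exists s : 'cV[R]_m * 'cV[R]_m,
    unique (pd_system tau mu phi) s /\
    ((fun k => (x k, y k)) @ \oo --> s)).
Proof.
have L0 : 0 < (lambda_1 + tau / mu) / 2.
  by rewrite divr_gt0 // addr_gt0 ?divr_gt0 // (lt_le_trans hlambda_m).
have g0 := minimizer_gradient0 L0
  (objective_quad_upper htau hmu hphi hupper xstar) hxstar.
have [cx cy] := pdNCG_cvg htau hmu hphi hlambda_m hlambda hlower hupper
  hc2 hc3 heta hxy hxstar g0.
split=> //; exists (xstar, Dmx mu xstar *m xstar); split; last exact: (cvg_pair cx cy).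
split; first by apply/pd_systemP => //; exact: hphi.1.
move=> [x1 y1] /pd_systemP - /(_ hmu (hphi.1 _)) [-> gx1].
suff -> : x1 = xstar by [].
(* Uniqueness: the gradient vanishes at [x1], so the error bound makes its distance to [xstar]
   zero. *)
have := objective_dist_minimizer htau hmu hphi hlambda_m hlower x1 g0.
rewrite gx1 {2}/norm2 dotp0l sqrtr0 pmulr_rle0 // => n0.
apply/eqP; rewrite -subr_eq0 -dotp_eq0 -sqr_norm2 expf_eq0 /=.
by rewrite eq_le n0 norm2_ge0.
Qed.
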